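(* Let $A\in\mathbb{C}^{n\times n}$ and $D\in\mathbb{C}^{m\times m}$ be Hermitian matrices. Let $\lambda_1\geq\ldots\geq\lambda_k>0\geq\lambda_{k+1}\geq\ldots\geq\lambda_n$ be the eigenvalues of $A$ and let $\mu_1\leq\ldots\leq\mu_r\leq 0<\mu_{r+1}\leq\ldots\leq\mu_m$ be the eigenvalues of $D$ (counted with multiplicities), and let $p=\dim(\ker D)$. Let $\kappa>0$ and assume that $$r-p\leq k\quad\text{and}\quad \kappa^2\lambda_i+\mu_i\geq 0\ \text{ for all } i=1,\ldots,r-p.$$ For $i=1,\ldots,r-p$ choose $0<\varepsilon_i\leq\kappa^2$ such that $\varepsilon_i\lambda_i+\mu_i\geq 0$, and for $j=r-p+1,\ldots,r$ set $\varepsilon_j=0$. Let $U\in\mathbb{C}^{n\times n}$ and $V\in\mathbb{C}^{m\times m}$ be unitary matrices with $A=U\,\mathrm{diag}(\lambda_1,\ldots,\lambda_n)\,U^*$ and $D=V\,\mathrm{diag}(\mu_1,\ldots,\mu_m)\,V^*$, let $E\in\mathbb{C}^{n\times m}$ be the matrix whose $(i,i)$ entry is $\sqrt{\varepsilon_i}$ for $i=1,\ldots,r-p$ and all of whose other entries are zero, and let $K:=UEV^*\in\mathbb{C}^{n\times m}$. Set $$\alpha_i:=\frac{(\lambda_i-\mu_i)^2}{4\lambda_i^2},\quad i=1,\ldots,r-p.$$ Then $\|K\|\leq\kappa$ and the spectrum of the block matrix $$S=\begin{bmatrix}A&-AK\\ K^*A&D\end{bmatrix}\in\mathbb{C}^{(n+m)\times(n+m)}$$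 consists of the real numbers $\lambda_{r-p+1},\ldots,\lambda_n$, $\mu_{r-p+1},\ldots,\mu_m$, and $$\eta_i^\pm=\frac{\lambda_i+\mu_i}{2}\pm\lambda_i\sqrt{\alpha_i-\varepsilon_i},\quad i=1,\ldots,r-p.$$ Moreover, for $i\in\{1,\ldots,r-p\}$, we have: a) if $0<\varepsilon_i<\frac{-\mu_i}{\lambda_i}$, then $\lambda_i>\eta_i^+>0>\eta_i^->\mu_i$; b) if $\frac{-\mu_i}{\lambda_i}\leq\varepsilon_i<\alpha_i$, then $\max\{\lambda_i+\mu_i,0\}\geq\eta_i^+>\eta_i^-\geq\min\{\lambda_i+\mu_i,0\}$; c) if $\alpha_i<\varepsilon_i\leq\kappa^2$, then $\eta_i^+=\overline{\eta_i^-}\in\mathbb{C}\setminus\mathbb{R}$; d) if $\varepsilon_i=\alpha_i$, then $\eta_i^+=\eta_i^-=\frac12(\lambda_i+\mu_i)$ and there exists a Jordan chain of $S$ of length $2$ corresponding to this eigenvalue. Additionally, if $\varepsilon_i\neq\alpha_i$ for all $i=1,\ldots,r-p$, then $S$ is diagonalizable.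
   Context: $\|K\|$ denotes the spectral norm (largest singular value) of $K$. The integer $k$ is the number of positive eigenvalues of $A$ and $r$ is the number of non-positive eigenvalues of $D$, counted with multiplicities, so $r-p$ is the number of negative eigenvalues of $D$; note $\lambda_i>0$ for $i\leq r-p$. For $\alpha_i-\varepsilon_i<0$, the square root $\sqrt{\alpha_i-\varepsilon_i}$ means $\mathrm{i}\sqrt{\varepsilon_i-\alpha_i}$, where $\mathrm{i}$ is the imaginary unit. A Jordan chain of length $2$ of $S$ for the eigenvalue $\eta$ is a pair of vectors $v_1\neq 0$, $v_2$ with $(S-\eta I)v_1=0$ and $(S-\eta I)v_2=v_1$. *)

(* Defs.v *)
From mathcomp Require Import all_boot all_order all_algebra spectral.
From mathcomp Require Import classical_sets reals.
From mathcomp Require Import complex.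

Set Implicit Arguments.
Unset Strict Implicit.
Unset Printing Implicit Defensive.

Import Order.TTheory GRing.Theory Num.Theory.

Local Open Scope sesquilinear_scope.
Local Open Scope ring_scope.
Local Open Scope complex_scope.

(* The complex numbers are R[i] for R : realType.  The order of R[i] is the
   partial one of a numClosedFieldType: x <= y iff y - x is real and
   nonnegative, so comparing z with a real number also says that z is real. *)

Section Defs.
Variable R : realType.

(* The principal choice sqrt x = i * sqrt (- x) for x < 0. *)
Definition csqrt (x : R) : R[i] :=
  if 0 <= x then (Num.sqrt x)%:C else 'i * (Num.sqrt (- x))%:C.

Definition singular_value (n m : nat) (K : 'M[R[i]]_(n, m)) (s : R) : Prop :=
  0 <= s /\ eigenvalue (K^t* *m K) (s ^+ 2)%:C.

(* The set of singular values is finite, so the supremum is a maximum (and is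
   0 if m = 0). *)
Definition spectral_norm (n m : nat) (K : 'M[R[i]]_(n, m)) : R :=
  sup [set s | singular_value K s]%classic.

(* [eigenvalue] gives the spectrum as a set; the characteristic polynomial says
   that s lists the eigenvalues with their algebraic multiplicities. *)
Definition spectrum_is (n : nat) (M : 'M[R[i]]_n) (s : seq R[i]) : Prop :=
  (forall z, eigenvalue M z <-> z \in s) /\
  char_poly M = \prod_(z <- s) ('X - z%:P).

Definition jordan_chain2 (n : nat) (M : 'M[R[i]]_n) (eta : R[i])
    (v1 v2 : 'cV[R[i]]_n) : Prop :=
  [/\ v1 != 0, (M - eta%:M) *m v1 = 0 & (M - eta%:M) *m v2 = v1].

Definition real_diag (n : nat) (d : nat -> R) : 'M[R[i]]_n :=
  diag_mx (\row_(i < n) (d i)%:C).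

Definition Emx (n m q : nat) (eps : nat -> R) : 'M[R[i]]_(n, m) :=
  \matrix_(i < n, j < m)
    if (i == j :> nat) && (i < q)%N then (Num.sqrt (eps i))%:C else 0.

Definition Smx (n m : nat) (A : 'M[R[i]]_n) (D : 'M[R[i]]_m)
    (K : 'M[R[i]]_(n, m)) : 'M[R[i]]_(n + m) :=
  block_mx A (- (A *m K)) (K^t* *m A) D.

Definition alpha (l mu : R) : R := (l - mu) ^+ 2 / (4 * l ^+ 2).

Definition eta_plus (l mu e : R) : R[i] :=
  ((l + mu) / 2)%:C + l%:C * csqrt (alpha l mu - e).

Definition eta_minus (l mu e : R) : R[i] :=
  ((l + mu) / 2)%:C - l%:C * csqrt (alpha l mu - e).

End Defs.

(* Main.v *)
Require Import Defs.
From mathcomp Require Import all_boot all_order all_algebra spectral.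
From mathcomp Require Import reals complex.
From mathcomp Require Import classical_sets.
From mathcomp Require Import ring lra.

Import Order.TTheory GRing.Theory Num.Theory.

Local Open Scope sesquilinear_scope.
Local Open Scope ring_scope.
Local Open Scope complex_scope.

(** The singular vectors of [K] are eigenvectors of [A] and [D], so the change
    of basis [diag (U, V)] turns [S] into a block matrix all of whose blocks
    are (rectangular) diagonal ([Smx_block_rdiag]).  Up to reordering the basis
    this is a direct sum of the scalars [lam i] and [mu i] with
    [r - p <= i] and of the 2 x 2 matrices
<<
        [ lam i               - lam i sqrt (eps i) ]
        [ lam i sqrt (eps i)    mu i               ]
>>
    with [i < r - p].  The trace of such a matrix is [lam i + mu i] and its
    determinant is [lam i * mu i + eps i * lam i ^ 2], so its eigenvalues are
    [eta_plus] and [eta_minus] ([eta_sum], [eta_prod]).  Its off-diagonal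
    entries are nonzero, hence it is never scalar: it is diagonalizable when
    the two eigenvalues differ, that is when [eps i] is not [alpha], and it is
    a single Jordan block of size 2 when they agree.

    Reordering a basis is cumbersome with matrices, and it is avoided.  All the
    2 x 2 matrices are triangularized at once by one block shear
    [[1, 0], [G, 1]] with [G] rectangular diagonal
    ([block_rdiag_triangularize]); the result is block upper triangular with
    diagonal blocks, so its characteristic polynomial and its Jordan chains are
    visible.  If the eigenvalues of each pair differ, a second shear
    [[1, H], [0, 1]] removes the remaining off-diagonal block
    ([diagonalizable_block_rdiag]).

    The location of [eta_plus] and [eta_minus] is elementary.  As long as
    [eps <= alpha], they are [(lam + mu) / 2 + t] and [(lam + mu) / 2 - t] with
    [t >= 0] and
    [t ^ 2 = ((lam - mu) / 2) ^ 2 - eps * lam ^ 2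
           = ((lam + mu) / 2) ^ 2 - lam * (eps * lam + mu)];
    the first expression compares [t] with [(lam - mu) / 2], the second one
    with the absolute value of [(lam + mu) / 2], according to the sign of
    [eps * lam + mu].  The bound on the norm holds because [K^* K] is unitarily
    similar to the diagonal matrix with entries [eps i] and 0. *)

(** * Similarity *)

(** Similarity is used in the form [A X = X B], which avoids inverses. *)

Lemma char_poly_intertwine (F : fieldType) (n : nat) (A B X : 'M[F]_n) :
  X \in unitmx -> A *m X = X *m B -> char_poly A = char_poly B.
Proof.
move=> uX AX; have detX_neq0 : \det (map_mx polyC X) != 0.
  by rewrite det_map_mx polyC_eq0 -unitfE -unitmxE.
apply: (mulIf detX_neq0); rewrite [RHS]mulrC /char_poly -!det_mulmx.
congr (\det _); rewrite /char_poly_mx mulmxBl mulmxBr -!map_mxM AX.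
by rewrite scalar_mxC.
Qed.

Lemma char_poly_ublock (F : fieldType) (n m : nat) (A : 'M[F]_n)
    (B : 'M[F]_(n, m)) (D : 'M[F]_m) :
  char_poly (block_mx A B 0 D) = char_poly A * char_poly D.
Proof.
rewrite /char_poly -(det_ublock _ (- map_mx polyC B)); congr (\det _).
rewrite /char_poly_mx map_block_mx scalar_mx_block opp_block_mx add_block_mx.
by rewrite map_mx0 subr0 add0r.
Qed.

Lemma diagonalizable_intertwine (F : fieldType) (n : nat) (A B X : 'M[F]_n) :
  X \in unitmx -> A *m X = X *m B -> diagonalizable B -> diagonalizable A.
Proof.
move=> uX AX [P uP /similar_diagPex[d /(similarP uP) PB]].
have uPX : P *m invmx X \in unitmx by rewrite unitmx_mul uP unitmx_inv.
exists (P *m invmx X) => //; apply/similar_diagPex; exists d.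
by apply/(similarP uPX); rewrite -[A](mulmxK uX) AX !mulmxA mulmxKV // PB.
Qed.

Lemma jordan_chain2_intertwine (R : realType) (n : nat) (A B X : 'M[R[i]]_n)
    (eta : R[i]) (v1 v2 : 'cV[R[i]]_n) :
  X \in unitmx -> A *m X = X *m B -> jordan_chain2 B eta v1 v2 ->
  jordan_chain2 A eta (X *m v1) (X *m v2).
Proof.
move=> uX AX [v1_neq0 Bv1 Bv2].
have shiftX : (A - eta%:M) *m X = X *m (B - eta%:M).
  by rewrite mulmxBl mulmxBr AX scalar_mxC.
split; last by rewrite mulmxA shiftX -mulmxA Bv2.
  by apply: contra_neq v1_neq0 => Xv1; rewrite -[v1](mulKmx uX) Xv1 mulmx0.
by rewrite mulmxA shiftX -mulmxA Bv1 mulmx0.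
Qed.

Lemma spectrum_is_char_poly (R : realType) (n : nat) (M : 'M[R[i]]_n)
    (s : seq R[i]) :
  char_poly M = \prod_(z <- s) ('X - z%:P) -> spectrum_is M s.
Proof.
by move=> chM; split=> // z; rewrite eigenvalue_root_char chM root_prod_XsubC.
Qed.

(** * Rectangular diagonal matrices *)

(** The diagonal is given by a sequence on [nat], so that blocks of different
    shapes can share it. *)
Definition rdiag (F : fieldType) (n m : nat) (d : nat -> F) : 'M[F]_(n, m) :=
  \matrix_(i, j) (d i *+ (i == j :> nat)).
Arguments rdiag {F} n m d.

Section RectangularDiagonal.
Variable F : fieldType.
Implicit Types (n m l : nat) (d : nat -> F).

Lemma eq_rdiag n m d d' : (forall i, (i < n)%N -> (i < m)%N -> d i = d' i) ->
  rdiag n m d = rdiag n m d'.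
Proof.
move=> eq_d; apply/matrixP=> i j; rewrite !mxE.
by case: eqP => // eq_ij; rewrite eq_d // eq_ij.
Qed.

Lemma rdiagD n m d d' :
  rdiag n m d + rdiag n m d' = rdiag n m (fun i => d i + d' i).
Proof. by apply/matrixP=> i j; rewrite !mxE mulrnDl. Qed.

Lemma rdiagN n m d : - rdiag n m d = rdiag n m (fun i => - d i).
Proof. by apply/matrixP=> i j; rewrite !mxE mulNrn. Qed.

(** The indices [i >= m] have to be excluded because the inner dimension cuts
    the product off there, even when both outer dimensions exceed [m]. *)
Lemma rdiagM n m l d d' : (forall i, (m <= i)%N -> d i * d' i = 0) ->
  rdiag n m d *m rdiag m l d' = rdiag n l (fun i => d i * d' i).
Proof.
move=> out0; apply/matrixP=> i j; rewrite !mxE.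
have [lt_im|le_mi] := ltnP i m.
  rewrite (bigD1 (Ordinal lt_im)) //= !mxE eqxx mulrnAr big1 ?addr0 // => k.
  by rewrite -val_eqE eq_sym !mxE /= => /negPf->; rewrite mul0r.
rewrite out0 // mul0rn big1 // => k _; rewrite !mxE gtn_eqF ?mul0r //.
exact: leq_trans le_mi.
Qed.

Lemma rdiag_delta n m d (i : 'I_n) (j : 'I_m) : i = j :> nat ->
  rdiag n m d *m delta_mx j (0 : 'I_1) = d i *: delta_mx i 0.
Proof.
move=> eq_ij; apply/matrixP=> k z; rewrite !mxE (bigD1 j) //= !mxE.
rewrite eqxx ord1 /= big1 ?addr0 ?mulr1 => [|h /negPf ne]; last first.
  by rewrite !mxE ne mulr0.
rewrite andbT -eq_ij -val_eqE /=.
by case: eqP => [->|_]; rewrite ?mulr1 ?mulr0.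
Qed.

Lemma rdiag_is_diag n m d : is_diag_mx (rdiag n m d).
Proof. by apply/is_diag_mxP=> i j /negPf ne; rewrite mxE ne. Qed.

Lemma char_poly_rdiag n d :
  char_poly (rdiag n n d) = \prod_(z <- [seq d i | i <- iota 0 n]) ('X - z%:P).
Proof.
rewrite big_map.
rewrite char_poly_trig ?is_diag_mx_is_trig ?rdiag_is_diag //.
rewrite -[n in iota 0 n]subn0 big_mkord.
by apply: eq_bigr => i _; rewrite mxE eqxx.
Qed.

(** * Block matrices with diagonal blocks *)

(** For each [i < q] the sequences encode a 2 x 2 matrix
    [[a i, b i], [c i, d i]] with trace [hp i + hm i] and determinant
    [hp i * hm i]; [b] vanishes from [q] on, so [q] bounds the number of pairs
    of basis vectors that interact. *)
Section DiagonalBlocks.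
Variables (q n m : nat) (a b c d hp hm : nat -> F).
Hypotheses (le_qn : (q <= n)%N) (le_qm : (q <= m)%N).
Hypothesis b_out : forall i, (q <= i)%N -> b i = 0.
Hypothesis trE : forall i, hp i + hm i = a i + d i.
Hypothesis detE : forall i, hp i * hm i = a i * d i - b i * c i.
Hypothesis uncoupled : forall i, b i = 0 -> c i = 0 /\ hp i = a i.

(* [(1, g i)] is an eigenvector for [hp i] when [b i != 0]; when [b i = 0],
   [g i] is 0, as the inverse of 0 is 0. *)
Let g i := (hp i - a i) / b i.
(* [(h i, 1)] is an eigenvector of [[hp i, b i], [0, hm i]] for [hm i], when the
   two are distinct. *)
Let h i := b i / (hm i - hp i).

Let b_supp i : (n <= i)%N || (m <= i)%N -> b i = 0.
Proof. by case/orP=> le_i; apply: b_out; apply: leq_trans le_i. Qed.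

Let g_out i : b i = 0 -> g i = 0.
Proof. by rewrite /g => ->; rewrite invr0 mulr0. Qed.

Let lowerP : 'M[F]_(n + m) := block_mx 1%:M 0 (rdiag m n g) 1%:M.
Let upperP : 'M[F]_(n + m) := block_mx 1%:M (rdiag n m h) 0 1%:M.

Let lowerP_unit : lowerP \in unitmx.
Proof. by rewrite unitmxE det_lblock !det1 mulr1 unitr1. Qed.

Let upperP_unit : upperP \in unitmx.
Proof. by rewrite unitmxE det_ublock !det1 mulr1 unitr1. Qed.

(** In the basis [(1, g i), (0, 1)] a 2 x 2 matrix with eigenvalues [hp i] and
    [hm i] becomes [[hp i, b i], [0, hm i]]; the off-diagonal entry survives
    unchanged, which is what decides between a Jordan block and a
    diagonalizable matrix. *)
Lemma block_rdiag_triangularize : exists2 X : 'M[F]_(n + m), X \in unitmx &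
  block_mx (rdiag n n a) (rdiag n m b) (rdiag m n c) (rdiag m m d) *m X =
  X *m block_mx (rdiag n n hp) (rdiag n m b) 0 (rdiag m m hm).
Proof.
exists lowerP => //; rewrite /lowerP !mulmx_block.
rewrite ?(mulmx0, mul0mx, mulmx1, mul1mx, add0r, addr0).
have outb i : (m <= i)%N -> b i * g i = 0.
  by move=> le_mi; rewrite b_supp ?le_mi ?orbT // mul0r.
have outg i : (m <= i)%N || (n <= i)%N -> g i = 0.
  by move=> le_i; rewrite g_out // b_supp // orbC.
rewrite rdiagM // rdiagM => [|i le]; last by rewrite outg ?le // mulr0.
rewrite rdiagM => [|i le]; last by rewrite outg ?le ?orbT // mul0r.
rewrite rdiagM => [|i le]; last by rewrite outg ?le ?orbT // mul0r.
rewrite !rdiagD; congr block_mx; apply: eq_rdiag => i _ _.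
- have [b0|b_neq0] := eqVneq (b i) 0; last by rewrite /g; field.
  by rewrite g_out // mulr0 addr0 (uncoupled _ b0).2.
- have [b0|b_neq0] := eqVneq (b i) 0.
    by rewrite g_out // mulr0 mul0r addr0 (uncoupled _ b0).1.
  (* The Riccati equation for the slope [g i] is [(hp - a) (hp - d) = b c],
     the characteristic equation of the i-th 2 x 2 matrix at [hp i]. *)
  apply: (mulfI b_neq0); rewrite /g.
  have hmE : hm i = a i + d i - hp i by rewrite -trE addrC addKr.
  have := detE i; rewrite hmE => dE.
  have bcE : b i * c i = a i * d i - hp i * (a i + d i - hp i).
    by rewrite dE opprB addrC subrK.
  by rewrite mulrDr bcE; field.
- have [b0|b_neq0] := eqVneq (b i) 0.
    have := trE i; rewrite g_out // mul0r add0r (uncoupled _ b0).2.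
    by move/addrI.
  by rewrite /g divfK // -[d i](addKr (a i)) -trE; ring.
Qed.

Lemma char_poly_block_rdiag :
  char_poly
    (block_mx (rdiag n n a) (rdiag n m b) (rdiag m n c) (rdiag m m d)) =
  \prod_(z <- [seq hp i | i <- iota 0 n] ++ [seq hm i | i <- iota 0 m])
    ('X - z%:P).
Proof.
have [X uX /(char_poly_intertwine _ _ _ _ _ uX)->] := block_rdiag_triangularize.
by rewrite char_poly_ublock !char_poly_rdiag big_cat.
Qed.

Lemma diagonalizable_block_rdiag :
  (forall i, b i != 0 -> hp i != hm i) ->
  diagonalizable
    (block_mx (rdiag n n a) (rdiag n m b) (rdiag m n c) (rdiag m m d)).
Proof.
move=> hpm; have [X uX TX] := block_rdiag_triangularize.
apply: (@diagonalizable_intertwine _ _ _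
          (block_mx (rdiag n n hp) 0 0 (rdiag m m hm)) (X *m upperP)).
- by rewrite unitmx_mul uX upperP_unit.
- rewrite mulmxA TX -!mulmxA; congr (_ *m _); rewrite /upperP !mulmx_block.
  rewrite ?(mulmx0, mul0mx, mulmx1, mul1mx, add0r, addr0).
  have outh i : (n <= i)%N || (m <= i)%N -> h i = 0.
    by move=> le_i; rewrite /h b_supp // mul0r.
  rewrite rdiagM => [|i le]; last by rewrite outh ?le // mulr0.
  rewrite rdiagM => [|i le]; last by rewrite outh ?le ?orbT // mul0r.
  rewrite rdiagD; congr block_mx; apply: eq_rdiag => i _ _; rewrite /h.
  have [->|/hpm] := eqVneq (b i) 0; first by rewrite !mul0r mulr0 addr0.
  by rewrite eq_sym -subr_eq0 => ?; field.
- have /diag_mxP[r ->] : is_diag_mx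
      (block_mx (rdiag n n hp) 0 0 (rdiag m m hm)).
    by rewrite is_diag_block_mx // !rdiag_is_diag !eqxx.
  exact: diagonalizable_diag.
Qed.

End DiagonalBlocks.
End RectangularDiagonal.

(** When [hp i = hm i], the triangular matrix [[hp i, b i], [0, hm i]] is
    [hp i] plus a nonzero nilpotent matrix sending the second basis vector to
    [b i] times the first. *)
Lemma jordan_chain2_rdiag (R : realType) (n m : nat) (hp b hm : nat -> R[i])
    (i : 'I_n) (j : 'I_m) :
  i = j :> nat -> b i != 0 -> hp i = hm i ->
  jordan_chain2
    (block_mx (rdiag n n hp) (rdiag n m b) 0 (rdiag m m hm) : 'M_(n + m))
    (hp i) (col_mx (b i *: delta_mx i 0) 0) (col_mx 0 (delta_mx j 0)).
Proof.
move=> eq_ij b_neq0 eq_h; split.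
- rewrite col_mx_eq0 negb_and scaler_eq0 (negPf b_neq0) /=; apply/orP; left.
  by apply/eqP=> /matrixP/(_ i 0)/eqP; rewrite !mxE !eqxx oner_eq0.
- rewrite mulmxBl mul_block_col mul_scalar_mx !mulmx0 mul0mx !addr0.
  by rewrite -scalemxAr (@rdiag_delta _ _ _ hp i i erefl) scale_col_mx scaler0
             scalerA mulrC
             -scalerA subrr.
- rewrite mulmxBl mul_block_col mul_scalar_mx !mulmx0 !add0r.
  rewrite (@rdiag_delta _ _ _ b i j eq_ij) (@rdiag_delta _ _ _ hm j j erefl)
          scale_col_mx scaler0.
  by rewrite opp_col_mx add_col_mx subr0 eq_h eq_ij subrr.
Qed.

(** * The numbers eta *)

Section Eta.
Variable R : realType.
Implicit Types (l mu e x : R).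

Lemma csqrt_sqr x : csqrt x ^+ 2 = x%:C.
Proof.
rewrite /csqrt; case: (leP 0 x) => [x_ge0|x_lt0].
  by rewrite -rmorphXn /= sqr_sqrtr.
rewrite exprMn -rmorphXn /= sqr_sqrtr ?oppr_ge0 ?ltW //.
by rewrite sqr_i mulN1r -rmorphN opprK.
Qed.

Lemma csqrt_eq0 x : (csqrt x == 0) = (x == 0).
Proof. by rewrite -sqrf_eq0 csqrt_sqr -(inj_eq (@complexI R)). Qed.

Lemma alphaE l mu : l != 0 -> alpha l mu * l ^+ 2 = ((l - mu) / 2) ^+ 2.
Proof. by move=> l_neq0; rewrite /alpha; field. Qed.

Lemma eta_sum l mu e : eta_plus l mu e + eta_minus l mu e = l%:C + mu%:C.
Proof.
rewrite /eta_plus /eta_minus addrACA subrr addr0 -!rmorphD /=.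
by congr _%:C; field.
Qed.

Lemma eta_prod l mu e : l != 0 ->
  eta_plus l mu e * eta_minus l mu e = (l * mu + e * l ^+ 2)%:C.
Proof.
move=> l_neq0; rewrite /eta_plus /eta_minus mulrC -subr_sqr exprMn csqrt_sqr.
rewrite -!rmorphXn -rmorphM -rmorphB /=; congr _%:C.
by rewrite mulrBr [_ * alpha _ _]mulrC alphaE //; field.
Qed.

Lemma eta_eq l mu e : l != 0 ->
  (eta_plus l mu e == eta_minus l mu e) = (e == alpha l mu).
Proof.
move=> l_neq0; rewrite /eta_plus /eta_minus (inj_eq (addrI _)) -subr_eq0 opprK.
rewrite -mulr2n mulrn_eq0 /= mulf_eq0 csqrt_eq0 subr_eq0 [e == _]eq_sym.
by rewrite (inj_eq (@complexI R) l 0) (negPf l_neq0).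
Qed.

(** The two numbers are real as long as the radicand is nonnegative; their
    half-distance [t] is determined by its square, so bounds on [t] become
    polynomial inequalities. *)
Lemma eta_real l mu e : 0 < l -> e <= alpha l mu -> exists2 t : R,
  0 <= t /\ t ^+ 2 = ((l - mu) / 2) ^+ 2 - e * l ^+ 2 &
  eta_plus l mu e = ((l + mu) / 2 + t)%:C /\
  eta_minus l mu e = ((l + mu) / 2 - t)%:C.
Proof.
move=> l_gt0 le_e; have al_ge0 : 0 <= alpha l mu - e by rewrite subr_ge0.
exists (l * Num.sqrt (alpha l mu - e)).
  split; first by rewrite mulr_ge0 ?sqrtr_ge0 // ltW.
  by rewrite exprMn sqr_sqrtr // mulrC mulrBl alphaE ?gt_eqF.
by rewrite /eta_plus /eta_minus /csqrt al_ge0 -!rmorphM -!rmorphD -!rmorphB.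
Qed.

(** Here the product [l * (mu + e * l)] of the two numbers is negative. *)
Lemma eta_opposite_signs l mu e : 0 < l -> mu <= 0 -> 0 < e < - mu / l ->
  [/\ eta_plus l mu e < l%:C, 0 < eta_plus l mu e,
      eta_minus l mu e < 0 & mu%:C < eta_minus l mu e].
Proof.
move=> l_gt0 mu_le0 /andP[e_gt0]; rewrite ltr_pdivlMr // => el_lt.
have al_gt : e <= alpha l mu.
  have l2_gt0 : 0 < l ^+ 2 by rewrite exprn_gt0.
  rewrite -(ler_pM2r l2_gt0) alphaE ?gt_eqF //.
  have : 0 < l * (- mu - e * l) by rewrite mulr_gt0 // subr_gt0.
  (* [e * l ^ 2 < - l * mu <= ((l - mu) / 2) ^ 2], the last step being
     [(l + mu) ^ 2 >= 0]. *)
  have := sqr_ge0 (l + mu); nra.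
have [t [t_ge0 t2] [-> ->]] := eta_real _ _ _ l_gt0 al_gt.
have el2_gt0 : 0 < e * l ^+ 2 by rewrite mulr_gt0 // exprn_gt0.
have gap : e * l ^+ 2 < - (l * mu).
  by rewrite expr2 mulrA -mulrN [ltRHS]mulrC ltr_pM2r.
have t_lt : t < (l - mu) / 2.
  rewrite -(@ltr_pXn2r _ 2) ?nnegrE //; first by rewrite t2; lra.
  by lra.
have t_gt : `|(l + mu) / 2| < t.
  rewrite -(@ltr_pXn2r _ 2) ?nnegrE // -normrX ger0_norm ?sqr_ge0 // t2; nra.
move: t_gt; rewrite ltr_norml => /andP[t_gt1 t_gt2].
by rewrite !ltcR; split; lra.
Qed.

(** Here the product [l * (mu + e * l)] of the two numbers is nonnegative, so
    both lie between 0 and their sum. *)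
Lemma eta_same_sign l mu e : 0 < l -> - mu / l <= e < alpha l mu ->
  [/\ eta_plus l mu e <= (Num.max (l + mu) 0)%:C,
      eta_minus l mu e < eta_plus l mu e &
      (Num.min (l + mu) 0)%:C <= eta_minus l mu e].
Proof.
move=> l_gt0 /andP[]; rewrite ler_pdivrMr // => le_el lt_e.
have [t [t_ge0 t2] [-> ->]] := eta_real _ _ _ l_gt0 (ltW lt_e).
have t_gt0 : 0 < t.
  rewrite lt_neqAle t_ge0 andbT eq_sym -sqrf_eq0 t2 gt_eqF // subr_gt0.
  by rewrite -alphaE ?gt_eqF // ltr_pM2r // exprn_gt0.
have gap : - (l * mu) <= e * l ^+ 2.
  by rewrite expr2 mulrA -mulrN mulrC ler_pM2r.
have : t <= `|(l + mu) / 2|.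
  rewrite -(@ler_pXn2r _ 2) ?nnegrE // -normrX ger0_norm ?sqr_ge0 // t2; nra.
rewrite !lecR ltcR; case: (leP (l + mu) 0) => [le0|gt0].
  by rewrite ler0_norm; [split; lra|lra].
by rewrite ger0_norm; [split; lra|lra].
Qed.

Lemma eta_conjugate l mu e : 0 < l -> alpha l mu < e ->
  eta_plus l mu e = (eta_minus l mu e)^* /\ eta_plus l mu e \isn't Num.real.
Proof.
move=> l_gt0 lt_e; have lt0 : alpha l mu - e < 0 by rewrite subr_lt0.
rewrite /eta_plus /eta_minus /csqrt leNgt lt0 /=; simpc.
by split; rewrite // complex_real mulf_neq0 ?gt_eqF ?sqrtr_gt0 ?subr_gt0.
Qed.

End Eta.

(** * The norm of K and the block form of S *)

Section Matrices.
Variable R : realType.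
Implicit Types (l mu e : nat -> R) (n m q : nat).

Lemma trmxC_real_rdiag n m (d : nat -> R) :
  (rdiag n m (fun i => (d i)%:C))^t* = rdiag m n (fun i => (d i)%:C).
Proof.
apply/matrixP=> i j; rewrite !mxE eq_sym.
by case: eqP => [->|_] /=; apply/eqP; rewrite eq_complex /= ?oppr0 !eqxx.
Qed.

Definition sqrt_upto q e (i : nat) : R :=
  if (i < q)%N then Num.sqrt (e i) else 0.

Lemma Emx_rdiag n m q e :
  Emx n m q e = rdiag n m (fun i => (sqrt_upto q e i)%:C).
Proof.
apply/matrixP=> i j; rewrite !mxE /sqrt_upto.
by case: eqP => //= _; case: ifP.
Qed.

Lemma real_diag_rdiag n (d : nat -> R) :
  real_diag n d = rdiag n n (fun i => (d i)%:C).
Proof.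
by apply/matrixP=> i j; rewrite !mxE -val_eqE.
Qed.


Lemma trmxCM n m p (M : 'M[R[i]]_(n, m)) (N : 'M[R[i]]_(m, p)) :
  (M *m N)^t* = N^t* *m M^t*.
Proof. by rewrite trmx_mul map_mxM. Qed.

Lemma unitarymx_mulC n (W : 'M[R[i]]_n) : W \is unitarymx -> W^t* *m W = 1%:M.
Proof.
by move=> uW; rewrite -invmx_unitary // mulVmx // unitarymx_unit.
Qed.

Lemma spectral_norm_le n m (K : 'M[R[i]]_(n, m)) (kappa : R) : 0 <= kappa ->
  (forall s, singular_value K s -> s <= kappa) -> spectral_norm K <= kappa.
Proof.
move=> kappa_ge0 le_kappa; rewrite /spectral_norm.
have [->|/set0P sv_neq0] := eqVneq [set s | singular_value K s]%classic set0.
  by rewrite sup0.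
exact: ge_sup.
Qed.

Lemma spectral_norm_Emx n m q e (U : 'M[R[i]]_n) (V : 'M[R[i]]_m) (kappa : R) :
  (q <= n)%N -> 0 <= kappa ->
  (forall i, (i < q)%N -> 0 <= e i <= kappa ^+ 2) ->
  U \is unitarymx -> V \is unitarymx ->
  spectral_norm (U *m Emx n m q e *m V^t*) <= kappa.
Proof.
move=> le_qn kappa_ge0 le_e uU uV; apply: spectral_norm_le => // s [s_ge0].
rewrite Emx_rdiag !trmxCM trmxCK trmxC_real_rdiag.
set E := rdiag n m _; set E' := rdiag m n _.
have gramV : V *m (E' *m U^t*) *m (U *m E *m V^t*) *m V = V *m (E' *m E).
  by rewrite -!mulmxA unitarymx_mulC // mulmx1 [U^t* *m _]mulmxA
             unitarymx_mulC // mul1mx.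
rewrite eigenvalue_root_char.
rewrite (char_poly_intertwine _ _ _ _ _ (unitarymx_unit uV) gramV).
rewrite rdiagM => [|i le_ni]; last first.
  by rewrite /sqrt_upto ltnNge (leq_trans le_qn le_ni) mul0r.
rewrite char_poly_rdiag root_prod_XsubC => /mapP[i _].
rewrite -rmorphM => /complexI; rewrite -expr2 /sqrt_upto => s2.
rewrite -(@ler_pXn2r _ 2) ?nnegrE // s2.
case: ifP => [/le_e/andP[e_ge0 e_le]|_]; first by rewrite sqr_sqrtr.
by rewrite expr0n sqr_ge0.
Qed.

(** Since [A U = U diag l], [D V = V diag mu], and [K V = U E], every block of
    [S] becomes diagonal in the basis formed by the columns of [U] and [V]. *)
Lemma Smx_block_rdiag n m q l mu e (U : 'M[R[i]]_n) (V : 'M[R[i]]_m) :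
  (q <= n)%N -> (q <= m)%N -> U \is unitarymx -> V \is unitarymx ->
  let A := U *m real_diag n l *m U^t* in
  let D := V *m real_diag m mu *m V^t* in
  let W := block_mx U 0 0 V in
  let cpl i := (l i * sqrt_upto q e i)%:C in
  Smx A D (U *m Emx n m q e *m V^t*) *m W =
  W *m block_mx (rdiag n n (fun i => (l i)%:C)) (rdiag n m (fun i => - cpl i))
                (rdiag m n cpl) (rdiag m m (fun i => (mu i)%:C)).
Proof.
move=> le_qn le_qm uU uV A D W cpl; rewrite /A /D /W /Smx.
rewrite Emx_rdiag !real_diag_rdiag !trmxCM trmxCK trmxC_real_rdiag !mulmx_block.
rewrite !(mulmx0, mul0mx, addr0, add0r) -rdiagN.
have e_out i : (q <= i)%N -> sqrt_upto q e i = 0.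
  by rewrite /sqrt_upto ltnNge => ->.
have UU := unitarymx_mulC _ _ uU; have VV := unitarymx_mulC _ _ uV.
have UUM p (M : 'M[R[i]]_(n, p)) : U^t* *m (U *m M) = M.
  by rewrite mulmxA UU mul1mx.
congr block_mx; rewrite ?mulNmx ?mulmxN -!mulmxA ?UUM ?UU ?VV ?mulmx1 //.
- rewrite rdiagM => [|i le_ni]; last first.
    by rewrite e_out ?mulr0 // (leq_trans le_qn).
  by congr (- (_ *m _)); apply: eq_rdiag => i _ _; rewrite -rmorphM.
- rewrite rdiagM => [|i le_ni]; last first.
    by rewrite e_out ?mul0r // (leq_trans le_qn).
  by congr (_ *m _); apply: eq_rdiag => i _ _; rewrite -rmorphM mulrC.
Qed.

End Matrices.

(* Sequences of eigenvalues are indexed from 0: lam i, mu i and eps i stand for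
   the (i+1)-st items; only lam i with i < n, mu i with i < m and eps i with
   i < r matter. *)
Theorem theorem4p2 (R : realType) (n m : nat)
    (A : 'M[R[i]]_n) (D : 'M[R[i]]_m)
    (lam mu eps : nat -> R) (k r p : nat) (kappa : R)
    (U : 'M[R[i]]_n) (V : 'M[R[i]]_m) :
  A \is hermsymmx -> D \is hermsymmx ->
  (* eigenvalues of A *)
  spectrum_is A [seq (lam i)%:C | i <- iota 0 n] ->
  (forall i j, (i <= j < n)%N -> lam j <= lam i) ->
  (k <= n)%N ->
  (forall i, (i < k)%N -> 0 < lam i) ->
  (forall i, (k <= i < n)%N -> lam i <= 0) ->
  (* eigenvalues of D *)
  spectrum_is D [seq (mu i)%:C | i <- iota 0 m] ->
  (forall i j, (i <= j < m)%N -> mu i <= mu j) ->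
  (r <= m)%N ->
  (forall i, (i < r)%N -> mu i <= 0) ->
  (forall i, (r <= i < m)%N -> 0 < mu i) ->
  (* cokermx D is a matrix whose columns span the v with D *m v = 0 *)
  p = \rank (cokermx D) ->
  0 < kappa ->
  (r - p <= k)%N ->
  (forall i, (i < r - p)%N -> 0 <= kappa ^+ 2 * lam i + mu i) ->
  (forall i, (i < r - p)%N ->
     0 < eps i <= kappa ^+ 2 /\ 0 <= eps i * lam i + mu i) ->
  (forall j, (r - p <= j < r)%N -> eps j = 0) ->
  U \is unitarymx -> V \is unitarymx ->
  A = U *m real_diag n lam *m U^t* ->
  D = V *m real_diag m mu *m V^t* ->
  let K := U *m Emx n m (r - p) eps *m V^t* in
  let S := Smx A D K in
  let eta_p i := eta_plus (lam i) (mu i) (eps i) in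
  let eta_m i := eta_minus (lam i) (mu i) (eps i) in
  let al i := alpha (lam i) (mu i) in
  [/\ spectral_norm K <= kappa,
      spectrum_is S
        ([seq (lam i)%:C | i <- iota (r - p) (n - (r - p))] ++
         [seq (mu i)%:C | i <- iota (r - p) (m - (r - p))] ++
         [seq eta_p i | i <- iota 0 (r - p)] ++
         [seq eta_m i | i <- iota 0 (r - p)]),
      (forall i, (i < r - p)%N ->
        [/\ 0 < eps i < - mu i / lam i ->
              [/\ eta_p i < (lam i)%:C, 0 < eta_p i,
                  eta_m i < 0 & (mu i)%:C < eta_m i],
            - mu i / lam i <= eps i < al i ->
              [/\ eta_p i <= (Num.max (lam i + mu i) 0)%:C,
                  eta_m i < eta_p i &
                  (Num.min (lam i + mu i) 0)%:C <= eta_m i],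
            al i < eps i <= kappa ^+ 2 ->
              eta_p i = (eta_m i)^* /\ eta_p i \isn't Num.real &
            eps i = al i ->
              [/\ eta_p i = eta_m i,
                  eta_m i = ((lam i + mu i) / 2)%:C &
                  exists v1 v2 : 'cV[R[i]]_(n + m),
                    jordan_chain2 S (eta_p i) v1 v2]]) &
      (forall i, (i < r - p)%N -> eps i != al i) -> diagonalizable S].
Proof.
move=> _ _ _ _ le_kn lam_gt0 _ _ _ le_rm mu_le0 _ _ kappa_gt0 le_qk _ eps_bnd _.
move=> uU uV -> ->; set q := (r - p)%N in le_qk eps_bnd *.
move=> K S eta_p eta_m al.
have le_qn : (q <= n)%N := leq_trans le_qk le_kn.
have le_qr : (q <= r)%N := leq_subr p r.
have le_qm : (q <= m)%N := leq_trans le_qr le_rm.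
have l_gt0 i : (i < q)%N -> 0 < lam i.
  by move=> lt_iq; rewrite lam_gt0 // (leq_trans lt_iq).
have l_neq0 i : (i < q)%N -> lam i != 0 by move/l_gt0/gt_eqF->.
have e_gt0 i : (i < q)%N -> 0 < eps i by case/eps_bnd=> /andP[].
(* The coupling between the i-th eigenvectors of [A] and [D]. *)
pose cpl i := (lam i * sqrt_upto R q eps i)%:C.
pose hp i := if (i < q)%N then eta_p i else (lam i)%:C.
pose hm i := if (i < q)%N then eta_m i else (mu i)%:C.
have cpl_neq0 i : (i < q)%N -> - cpl i != 0.
  move=> lt_iq; rewrite oppr_eq0 /cpl /sqrt_upto lt_iq.
  rewrite (inj_eq (@complexI R) _ 0) mulf_neq0 ?l_neq0 //.
  by rewrite gt_eqF // sqrtr_gt0 e_gt0.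
have cpl_out i : (q <= i)%N -> - cpl i = 0.
  by move=> le_qi; rewrite /cpl /sqrt_upto ltnNge le_qi mulr0 oppr0.
have trE i : hp i + hm i = (lam i)%:C + (mu i)%:C.
  by rewrite /hp /hm; case: ifP => // _; rewrite eta_sum.
have detE i : hp i * hm i = (lam i)%:C * (mu i)%:C - - cpl i * cpl i.
  rewrite /hp /hm mulNr opprK /cpl /sqrt_upto; case: ifP => [lt_iq|_].
    rewrite eta_prod ?l_neq0 // -!rmorphM -rmorphD /=; congr _%:C.
    by rewrite -expr2 exprMn sqr_sqrtr ?ltW ?e_gt0 // [eps i * _]mulrC.
  by rewrite !mulr0 addr0.
have uncoupled i : - cpl i = 0 -> cpl i = 0 /\ hp i = (lam i)%:C.
  move=> cpl0; split; first by apply/eqP; rewrite -oppr_eq0 cpl0.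
  by rewrite /hp; case: ifP => // /cpl_neq0; rewrite cpl0 eqxx.
pose W := block_mx U 0 0 V.
have uW : W \in unitmx by rewrite block_diag_mx_unit !unitarymx_unit.
have SW := Smx_block_rdiag _ _ _ _ lam mu eps _ _ le_qn le_qm uU uV.
rewrite /= -/K -/S -/W in SW.
split.
- apply: spectral_norm_Emx => // [|i lt_iq]; first exact: ltW.
  by have [/andP[/ltW-> ->] _] := eps_bnd i lt_iq.
- apply: spectrum_is_char_poly; rewrite (char_poly_intertwine _ _ _ _ _ uW SW).
  rewrite (char_poly_block_rdiag _ q _ _ _ _ _ _ hp hm) //.
  have split_iota (f g : nat -> R[i]) k' : (q <= k')%N ->
      [seq (if (i < q)%N then f i else g i) | i <- iota 0 k'] =
      [seq f i | i <- iota 0 q] ++ [seq g i | i <- iota q (k' - q)].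
    move=> /subnKC {1}<-; rewrite iotaD map_cat add0n; congr (_ ++ _).
      by apply/eq_in_map=> i; rewrite mem_iota => /andP[_ ->].
    by apply/eq_in_map=> i; rewrite mem_iota => /andP[le_qi _];
       rewrite ltnNge le_qi.
  apply: perm_big; rewrite !split_iota // -!catA.
  by apply/permP=> P; rewrite !count_cat; ring.
- move=> i lt_iq; have li := l_gt0 i lt_iq.
  have mi : mu i <= 0 by rewrite mu_le0 // (leq_trans lt_iq).
  split.
  + exact: eta_opposite_signs.
  + exact: eta_same_sign.
  + by case/andP=> lt_e _; apply: eta_conjugate.
  + move=> e_al; have hpm : eta_p i = eta_m i.
      by apply/eqP; rewrite eta_eq ?l_neq0 // e_al.
    split=> //.
      rewrite /eta_m /eta_minus e_al subrr.
      have /eqP-> : csqrt (0 : R) == 0 by rewrite csqrt_eq0.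
      by rewrite mulr0 subr0.
    have [X uX TX] := block_rdiag_triangularize _ _ _ _ _ _ _ _ hp hm
                        le_qn le_qm cpl_out trE detE uncoupled.
    pose i_n : 'I_n := Ordinal (leq_trans lt_iq le_qn).
    pose i_m : 'I_m := Ordinal (leq_trans lt_iq le_qm).
    have chain : jordan_chain2
        (block_mx (rdiag n n hp) (rdiag n m (fun i => - cpl i))
                  0 (rdiag m m hm))
        (eta_p i) (col_mx (- cpl i *: delta_mx i_n 0) 0)
        (col_mx 0 (delta_mx i_m 0)).
      have hpE : hp i = eta_p i by rewrite /hp lt_iq.
      rewrite -hpE; apply: (@jordan_chain2_rdiag _ _ _ _ _ _ i_n i_m) => //=.
        exact: cpl_neq0.
      by rewrite /hp /hm lt_iq.
    do 2 eexists; apply: jordan_chain2_intertwine uW SW _.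
    exact: jordan_chain2_intertwine uX TX chain.
- move=> e_al; apply: diagonalizable_intertwine uW SW _.
  apply: (diagonalizable_block_rdiag _ q _ _ _ _ _ _ hp hm) => // i.
  rewrite /hp /hm; have [lt_iq _|le_qi] := ltnP i q.
    by rewrite eta_eq ?l_neq0 // e_al.
  by rewrite cpl_out // eqxx.
Qed.
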